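(* Let $f:\mathbb{R}^n\to\mathbb{R}$ be continuously differentiable with gradient $g$ uniformly continuous, and let $\{x_k\}$ be the sequence generated by the MARC algorithm (defined in the context). Write $g_k=g(x_k)$. If $\{f(x_k)\}$ is bounded below, then $$\lim_{k\to\infty}\|g_k\|=0.$$
   Context: $\|\cdot\|$ is the Euclidean norm, $f_k=f(x_k)$, $g_k=g(x_k)$. MARC algorithm (Modified Adaptive Regularization algorithm using Cubics). Input: $x_0\in\mathbb{R}^n$ and constants $\eta_2\ge\eta_1>0$, $c_1\ge1\ge c_2>0$, $\gamma_{\max}>\gamma_0>\gamma_{\min}>0$, $\sigma_0>0$. For $k=0,1,\dots$ until convergence: 1. Set $s_k=-\dfrac{2}{\gamma_k+\sqrt{\gamma_k^2+4\sigma_k\|g_k\|}}\,g_k$, which is the exact minimizer of the cubic model $m_k(s)=f(x_k)+g_k^Ts+\frac12\gamma_k s^Ts+\frac13\sigma_k\|s\|^3$. 2. Compute $f(x_k+s_k)$ and $\rho_k=\dfrac{f(x_k)-f(x_k+s_k)}{f(x_k)-m_k(s_k)}$. 3. Set $x_{k+1}=x_k+s_k$ if $\rho_k\ge\eta_1$, and $x_{k+1}=x_k$ otherwise. 4. Set $\sigma_{k+1}=c_2\sigma_k$ if $\rho_k>\eta_2$ (very successful iteration); $\sigma_{k+1}=\sigma_k$ if $\eta_1\le\rho_k\le\eta_2$ (successful iteration); $\sigma_{k+1}=c_1\sigma_k$ otherwise (unsuccessful iteration). 5. Compute a preliminary value $\hat\gamma_{k+1}$ and set $\gamma_{k+1}=\max\{\gamma_{\min},\min\{\hat\gamma_{k+1},\gamma_{\max}\}\}$.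 With $\delta_k=x_{k+1}-x_k$ and $y_k=g_{k+1}-g_k$, the value $\hat\gamma_{k+1}$ is computed by one of the formulas: (i) $\hat\gamma_{k+1}=\dfrac{\delta_k^Ty_k}{\delta_k^T\delta_k}$; (ii) $\hat\gamma_{k+1}=\dfrac{\delta_k^Ty_k+\theta_k[2(f_k-f_{k+1})+(g_k+g_{k+1})^T\delta_k]}{\delta_k^T\delta_k}$ with $\theta_k\in[0,3]$; (iii) $\hat\gamma_{k+1}=\dfrac{r_k^Tw_k}{r_k^Tr_k}$ with $r_k=\delta_k-\psi_k\delta_{k-1}$, $w_k=y_k-\psi_ky_{k-1}$, and a scalar $\psi_k\ge0$.
   Formalization: The formal theorem additionally assumes c_1 > 1 (instead of c_1 ≥ 1) and η_1 < 3/2; if c_1 = 1 or η_1 ≥ 3/2, there are quadratic f bounded below for which every step is rejected and the gradient norm stays constant and nonzero. *)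

(* Defs.v *)
From HB Require Import structures.
From mathcomp Require Import all_boot all_order all_algebra.
From mathcomp Require Import all_classical all_reals all_analysis.

Set Implicit Arguments.
Unset Strict Implicit.
Unset Printing Implicit Defensive.
Import Order.TTheory GRing.Theory Num.Theory.
Import numFieldNormedType.Exports.
Local Open Scope classical_set_scope.
Local Open Scope ring_scope.

Section Euclidean.
Context {R : realType} {n : nat}.
Implicit Types u v x : 'rV[R]_n.

Definition dot u v : R := \sum_i u 0 i * v 0 i.

(* The library's norm `|u| on row vectors is the maximum norm. *)
Definition enorm u : R := Num.sqrt (dot u u).

Definition grad (f : 'rV[R]_n -> R) x : 'rV[R]_n :=
  \row_i 'D_(delta_mx 0 i) f x.

Definition C1 (f : 'rV[R]_n -> R) : Prop :=
  (forall x, differentiable f x) /\ continuous (grad f).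

End Euclidean.

Record marc_constants (R : realType) := MarcConstants {
  eta1 : R; eta2 : R;
  c1 : R; c2 : R;
  gamma_min : R; gamma0 : R; gamma_max : R;
  sigma0 : R;
  eta1_gt0 : 0 < eta1;
  eta1_le_eta2 : eta1 <= eta2;
  c1_ge1 : 1 <= c1;
  c2_le1 : c2 <= 1;
  c2_gt0 : 0 < c2;
  gamma_min_gt0 : 0 < gamma_min;
  gamma_min_lt_gamma0 : gamma_min < gamma0;
  gamma0_lt_gamma_max : gamma0 < gamma_max;
  sigma0_gt0 : 0 < sigma0 }.

Section Marc.
Context {R : realType} {n : nat}.
Variable f : 'rV[R]_n -> R.

Definition cubic_model (gamma sigma : R) (x s : 'rV[R]_n) : R :=
  f x + dot (grad f x) s + 2^-1 * gamma * dot s s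
      + 3^-1 * sigma * enorm s ^+ 3.

Definition marc_step (gamma sigma : R) (x : 'rV[R]_n) : 'rV[R]_n :=
  - (2 / (gamma + Num.sqrt (gamma ^+ 2 + 4 * sigma * enorm (grad f x))))
    *: grad f x.

(* If grad f x = 0 the step is 0 and the quotient is 0 / 0 = 0: the iterates
   then stay at the stationary point x. *)
Definition marc_ratio (gamma sigma : R) (x : 'rV[R]_n) : R :=
  let s := marc_step gamma sigma x in
  (f x - f (x + s)) / (f x - cubic_model gamma sigma x s).

Variable x : nat -> 'rV[R]_n.

Definition iter_diff k : 'rV[R]_n := x k.+1 - x k.
Definition grad_diff k : 'rV[R]_n := grad f (x k.+1) - grad f (x k).

(* The Barzilai-Borwein quotients are undefined when their denominator
   vanishes, as after an unsuccessful iteration, where iter_diff k = 0; the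
   value is then left arbitrary. *)
Definition is_quotient (num den q : R) : Prop := den != 0 -> q = num / den.

Definition bb1 k (q : R) : Prop :=
  let d := iter_diff k in
  is_quotient (dot d (grad_diff k)) (dot d d) q.

Definition bb2 k (q : R) : Prop :=
  exists2 theta : R, 0 <= theta <= 3 &
    let d := iter_diff k in
    is_quotient
      (dot d (grad_diff k)
       + theta * (2 * (f (x k) - f (x k.+1))
                  + dot (grad f (x k) + grad f (x k.+1)) d))
      (dot d d) q.

Definition bb3 k (q : R) : Prop :=
  (0 < k)%N /\
  exists2 psi : R, 0 <= psi &
    let r := iter_diff k - psi *: iter_diff k.-1 in
    let w := grad_diff k - psi *: grad_diff k.-1 in
    is_quotient (dot r w) (dot r r) q.

(* x, gamma and sigma are the infinite sequences of a run of the algorithm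
   with constants P and starting point x 0; the formula for the preliminary
   value of gamma may change from one iteration to the next. *)
Record marc_run (P : marc_constants R) (gamma sigma : nat -> R) : Prop := {
  marc_gamma0 : gamma 0%N = gamma0 P;
  marc_sigma0 : sigma 0%N = sigma0 P;
  marc_x : forall k,
    x k.+1 = if eta1 P <= marc_ratio (gamma k) (sigma k) (x k)
             then x k + marc_step (gamma k) (sigma k) (x k)
             else x k;
  marc_sigma : forall k,
    sigma k.+1 =
      let rho := marc_ratio (gamma k) (sigma k) (x k) in
      if eta2 P < rho then c2 P * sigma k
      else if eta1 P <= rho then sigma k
      else c1 P * sigma k;
  marc_gamma : forall k, exists2 gamma_hat : R,
    [\/ bb1 k gamma_hat, bb2 k gamma_hat | bb3 k gamma_hat] &
    gamma k.+1 =
      Num.max (gamma_min P) (Num.min gamma_hat (gamma_max P)) }.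

End Marc.

(* Main.v *)
Require Import Defs.
From mathcomp Require Import all_boot all_order all_algebra.
From mathcomp Require Import all_classical all_reals all_analysis.
From mathcomp Require Import ring lra.
Import Order.TTheory GRing.Theory Num.Theory.
Import numFieldNormedType.Exports.
Local Open Scope classical_set_scope.
Local Open Scope ring_scope.

(** Write q_k for the Euclidean norm of the gradient at x_k, t_k for the length
of the trial step and eta for eta1. The trial step is antiparallel to the
gradient and satisfies q = gamma t + sigma t^2, so that the decrease promised
by the cubic model, gamma t^2 / 2 + 2 sigma t^3 / 3, lies between q t / 2 and
2 q t / 3 ([model_decrease_bounds]). Everything follows from these two bounds.

The lower bound gives, at every iteration, a decrease of f by at least
eta / 2 * q_k * |x_(k+1) - x_k| ([marc_decrease]). Since f (x_k) is bounded
below it is Cauchy, so as long as the gradients stay above e the iterates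
travel arbitrarily little, and by uniform continuity their gradients change
by at most e ([marc_grad_drift]). The whole sequence of the q_k therefore
tends to 0 as soon as q_k < e infinitely often for every e: from a late K, go
to the first later index at which q is below e; then q_K < 2 e.

The upper bound gives the lower limit. On a step that is short compared with
the modulus of continuity of the gradient, f decreases by almost q t, which
exceeds eta times the model decrease because 2 eta / 3 < 1; hence a rejected
step has a length bounded below ([marc_rejected_step]). Suppose that q_k >= e
from some point on. Then q_k is also bounded above, by the drift estimate, so
sigma_k <= q_k / t_k^2 is bounded at rejected steps, and since sigma only
grows there it is bounded altogether ([marc_sigma_bounded]). With gamma and
sigma bounded, q_k >= e bounds t_k from below, so each accepted step decreases
f by a fixed amount and only finitely many steps are accepted
([marc_eventually_rejected]). From then on sigma is multiplied by c1 > 1 at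
each iteration, which contradicts its boundedness ([marc_liminf]). *)

(** * Euclidean norm and gradient *)

Section EuclideanNorm.
Context {R : realType} {n : nat}.
Implicit Types u v w x s : 'rV[R]_n.

Lemma dotC u v : dot u v = dot v u.
Proof. by apply: eq_bigr => i _; rewrite mulrC. Qed.

Lemma dotDl u v w : dot (u + v) w = dot u w + dot v w.
Proof. by rewrite -big_split; apply: eq_bigr => i _; rewrite mxE mulrDl. Qed.

Lemma dotZl a u v : dot (a *: u) v = a * dot u v.
Proof. by rewrite mulr_sumr; apply: eq_bigr => i _; rewrite mxE mulrA. Qed.

Lemma dotDr u v w : dot u (v + w) = dot u v + dot u w.
Proof. by rewrite dotC dotDl !(dotC u). Qed.

Lemma dotZr a u v : dot u (a *: v) = a * dot u v.
Proof. by rewrite dotC dotZl (dotC u). Qed.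

Lemma dotBl u v w : dot (u - v) w = dot u w - dot v w.
Proof. by rewrite -scaleN1r dotDl dotZl mulN1r. Qed.

Lemma dot_ge0 u : 0 <= dot u u.
Proof. by apply: sumr_ge0 => i _; rewrite -expr2 sqr_ge0. Qed.

Lemma enorm_ge0 u : 0 <= enorm u.
Proof. exact: sqrtr_ge0. Qed.

Lemma enorm_sqr u : enorm u ^+ 2 = dot u u.
Proof. exact/sqr_sqrtr/dot_ge0. Qed.

Lemma enormZ a u : enorm (a *: u) = `|a| * enorm u.
Proof.
rewrite /enorm dotZl dotZr mulrA -expr2 sqrtrM ?sqr_ge0 //.
by rewrite sqrtr_sqr.
Qed.

Lemma enormN u : enorm (- u) = enorm u.
Proof. by rewrite -scaleN1r enormZ normrN1 mul1r. Qed.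

Lemma enorm0 : enorm (0 : 'rV[R]_n) = 0.
Proof. by rewrite -(scale0r 0) enormZ normr0 mul0r. Qed.

Lemma enorm_eq0 u : enorm u = 0 -> u = 0.
Proof.
move=> u0; have := enorm_sqr u; rewrite u0 expr0n /= => /esym/eqP.
rewrite psumr_eq0 => [/allP h|i _]; last by rewrite -expr2 sqr_ge0.
apply/rowP => i; have := h i; rewrite mem_index_enum => /(_ isT).
by rewrite /= mulf_eq0 orbb mxE => /eqP.
Qed.

(** Cauchy-Schwarz inequality, from the nonnegativity of the square of
[|v| u - |u| v]. *)
Lemma dot_le_enorm u v : dot u v <= enorm u * enorm v.
Proof.
have [a0|aP] := eqVneq (enorm u) 0.
  by rewrite a0 (enorm_eq0 _ a0) mul0r -(scale0r 0) dotZl mul0r.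
have [b0|bP] := eqVneq (enorm v) 0.
  by rewrite b0 (enorm_eq0 _ b0) mulr0 -(scale0r 0) dotZr mul0r.
have ab0 : 0 < enorm u * enorm v.
  by rewrite mulr_gt0 // lt_neqAle enorm_ge0 eq_sym ?aP ?bP.
have := dot_ge0 (enorm v *: u + (- enorm u) *: v).
rewrite dotDl !dotDr !dotZl !dotZr (dotC v u) -!enorm_sqr => h.
have : 0 <= enorm u * enorm v * (enorm u * enorm v - dot u v) by lra.
by rewrite pmulr_rge0 // subr_ge0.
Qed.

Lemma enormD u v : enorm (u + v) <= enorm u + enorm v.
Proof.
rewrite -ler_sqr ?nnegrE ?addr_ge0 ?enorm_ge0 //.
rewrite enorm_sqr dotDl !dotDr (dotC v u) sqrrD -!enorm_sqr.
have := dot_le_enorm u v; lra.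
Qed.

Lemma enorm_distC u v : enorm (u - v) = enorm (v - u).
Proof. by rewrite -enormN opprB. Qed.

(** The topology and the uniformity of row vectors come from the maximum norm;
this lemma and the next one transfer them to the Euclidean norm. *)
Lemma mx_norm_le_enorm u : `|u| <= enorm u.
Proof.
rewrite [`|u|]mx_normrE.
apply/bigmax_leP; split => [|[i j] _ /=]; first exact: enorm_ge0.
rewrite -ler_sqr ?nnegrE ?enorm_ge0 // enorm_sqr real_normK ?num_real //.
rewrite ord1 /dot (bigD1 j) //= -expr2 lerDl.
by apply: sumr_ge0 => k _; rewrite -expr2 sqr_ge0.
Qed.

Lemma enorm_le_mx_norm u : enorm u <= Num.sqrt n%:R * `|u|.
Proof.
rewrite -ler_sqr ?nnegrE ?mulr_ge0 ?sqrtr_ge0 ?enorm_ge0 //.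
rewrite enorm_sqr exprMn sqr_sqrtr ?ler0n //.
have -> : n%:R * `|u| ^+ 2 = \sum_(i < n) `|u| ^+ 2.
  by rewrite sumr_const card_ord mulr_natl.
apply: ler_sum => i _; rewrite -expr2 -real_normK ?num_real //.
rewrite ler_sqr ?nnegrE // [`|u|]mx_normrE.
by apply: (le_bigmax _ (fun ij : 'I_1 * 'I_n => `|u ij.1 ij.2|) (0, i)).
Qed.

Lemma unif_continuous_enorm (g : 'rV[R]_n -> 'rV[R]_n) (e : R) :
  unif_continuous g -> 0 < e ->
  exists2 d : R, 0 < d & forall x y, enorm (x - y) <= d ->
    enorm (g x - g y) <= e.
Proof.
move=> gu e0.
(* Adding 1 to the equivalence constant keeps it positive in dimension 0. *)
pose c : R := Num.sqrt n%:R + 1.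
have c0 : 0 < c by rewrite ltr_wpDl // sqrtr_ge0.
have /gu : entourage [set xy : 'rV[R]_n * 'rV[R]_n | ball xy.1 (e / c) xy.2].
  exact/(entourage_ball _ (PosNum (divr_gt0 e0 c0))).
rewrite /nbhs /= -entourage_ballE => -[d /= d0 h].
exists (d / 2) => [|x y xy]; first lra.
have /(h (x, y)) /= : ball x d y.
  rewrite mx_norm_ball /ball_ /=.
  by rewrite (le_lt_trans (mx_norm_le_enorm _)) // (le_lt_trans xy) //; lra.
rewrite mx_norm_ball /ball_ /= => /ltW gxy.
apply: le_trans (enorm_le_mx_norm _) _.
have -> : e = c * (e / c) by rewrite mulrC divfK // gt_eqF.
by rewrite ler_pM ?sqrtr_ge0 ?normr_ge0 // lerDl.
Qed.

Lemma derive_dot_grad (f : 'rV[R]_n -> R) x s :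
  differentiable f x -> 'D_s f x = dot (grad f x) s.
Proof.
move=> fx; rewrite deriveE // {1}(row_sum_delta s) linear_sum.
apply: eq_bigr => i _.
by rewrite linearZ /= -deriveE // mxE mulrC.
Qed.

(** The difference quotient of the restriction of f to a line is literally
that of the directional derivative. *)
Lemma is_derive_line (f : 'rV[R]_n -> R) x s (t : R) :
  differentiable f (x + t *: s) ->
  is_derive t 1 (fun t : R => f (x + t *: s)) (dot (grad f (x + t *: s)) s).
Proof.
move=> fx; pose phi (t : R) := f (x + t *: s).
have quotE :
    (fun h : R =>
       h^-1 *: ((f \o shift (x + t *: s)) (h *: s) - f (x + t *: s)))
    = (fun h : R => h^-1 *: ((phi \o shift t) (h *: (1 : R)) - phi t)).
  apply/funext => h /=; congr (_ *: (f _ - _)).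
  by rewrite [h *: (1 : R)]mulr1 scalerDl addrCA.
have dfs : derivable f (x + t *: s) s by exact: diff_derivable.
apply: DeriveDef; first by rewrite /derivable -quotE.
by rewrite -derive_dot_grad // /derive quotE.
Qed.

(** Mean value theorem along the segment from x to x + s, all of whose points
lie within the length of s from x. *)
Lemma increment_le (f : 'rV[R]_n -> R) x s (e : R) :
  (forall y, differentiable f y) ->
  (forall y, enorm (y - x) <= enorm s -> enorm (grad f y - grad f x) <= e) ->
  f (x + s) - f x <= dot (grad f x) s + e * enorm s.
Proof.
move=> fd ge.
have fl (t : R) := is_derive_line f x s t (fd _).
have phiC : {within `[0, 1], continuous (fun t : R => f (x + t *: s))}.
  by apply: derivable_within_continuous => t _; exact: ex_derive.
have [t] := MVT_segment ler01 (fun t _ => fl t) phiC.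
rewrite scale1r scale0r addr0 subr0 mulr1 => t01 ->.
rewrite -lerBlDl -dotBl; apply: le_trans (dot_le_enorm _ _) _.
rewrite ler_wpM2r ?enorm_ge0 // ge //.
rewrite addrC addKr enormZ; move: t01; rewrite in_itv /= => /andP[t0 t1].
by rewrite ger0_norm // ler_piMl ?enorm_ge0.
Qed.

End EuclideanNorm.

(** * The step and the acceptance test *)

Section Step.
Context {R : realType} {n : nat}.
Variables (f : 'rV[R]_n -> R) (x : 'rV[R]_n) (gamma sigma : R).
Hypotheses (gamma_gt0 : 0 < gamma) (sigma_gt0 : 0 < sigma).
Let s := marc_step f gamma sigma x.
Let q := enorm (grad f x).
Let t := enorm s.

Let t_ge0 : 0 <= t. Proof. exact: enorm_ge0. Qed.

(** The second equation says that the coefficient a is the positive root of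
sigma q a^2 + gamma a - 1, written with a rationalized numerator in the
definition of the step. *)
Lemma marc_stepE : exists2 a : R, 0 < a &
  s = (- a) *: grad f x /\ gamma * a + sigma * a ^+ 2 * q = 1.
Proof.
pose r := Num.sqrt (gamma ^+ 2 + 4 * sigma * q).
have r2 : r ^+ 2 = gamma ^+ 2 + 4 * sigma * q.
  by rewrite sqr_sqrtr // addr_ge0 ?sqr_ge0 ?mulr_ge0 ?enorm_ge0 // ltW.
have D0 : 0 < gamma + r by rewrite ltr_pwDl // sqrtr_ge0.
exists (2 / (gamma + r)); first exact: divr_gt0.
split=> //.
have -> : sigma * (2 / (gamma + r)) ^+ 2 * q
    = (r ^+ 2 - gamma ^+ 2) / (gamma + r) ^+ 2.
  by rewrite r2; field; rewrite gt_eqF.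
by field; rewrite gt_eqF.
Qed.

(** First-order condition for the minimizer of the cubic model. *)
Lemma enorm_grad_marc_step : q = gamma * t + sigma * t ^+ 2.
Proof.
have [a a0 [sE aE]] := marc_stepE.
have -> : t = a * q by rewrite /t sE enormZ normrN gtr0_norm.
by rewrite -[LHS]mul1r -aE; ring.
Qed.

Lemma dot_grad_marc_step : dot (grad f x) s = - (q * t).
Proof.
have [a a0 [sE _]] := marc_stepE.
rewrite /t sE dotZr enormZ normrN gtr0_norm // -enorm_sqr -/q; ring.
Qed.

Lemma model_decreaseE :
  f x - cubic_model f gamma sigma x s
  = 2^-1 * gamma * t ^+ 2 + 2 / 3 * sigma * t ^+ 3.
Proof.
rewrite /cubic_model dot_grad_marc_step -enorm_sqr -/t enorm_grad_marc_step.
by field.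
Qed.

(** After q t = gamma t^2 + sigma t^3, the quadratic part of the model decrease
is 1/2 and the cubic part 2/3 of the corresponding part of q t. *)
Lemma model_decrease_bounds :
  2^-1 * (q * t) <= f x - cubic_model f gamma sigma x s <= 2 / 3 * (q * t).
Proof.
rewrite model_decreaseE enorm_grad_marc_step.
have g2 : 0 <= gamma * t ^+ 2 by rewrite mulr_ge0 ?sqr_ge0 // ltW.
have s3 : 0 <= sigma * t ^+ 3 by rewrite mulr_ge0 ?exprn_ge0 // ltW.
by apply/andP; split; nra.
Qed.

Lemma accepted_decrease (eta : R) : 0 < eta ->
  eta <= marc_ratio f gamma sigma x ->
  eta / 2 * (q * t) <= f x - f (x + s).
Proof.
move=> eta0; rewrite /marc_ratio -/s.
have /andP[lo _] := model_decrease_bounds.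
have qt0 : 0 <= q * t by rewrite mulr_ge0 ?enorm_ge0.
set D := f x - cubic_model _ _ _ _ _ in lo *.
(* At a stationary point the ratio is 0 / 0 = 0, which is below eta. *)
have [->|D0] := eqVneq D 0; first by rewrite invr0 mulr0; lra.
have Dgt0 : 0 < D by rewrite lt_neqAle eq_sym D0; lra.
rewrite ler_pdivlMr // => h; nra.
Qed.

(** The constant is chosen so that the actual decrease, at least
q t - (1 - 2 eta / 3) q t, equals eta times the upper bound 2 q t / 3 of the
model decrease. *)
Lemma short_step_accepted (eta : R) : (forall y, differentiable f y) ->
  0 < eta -> 0 < q ->
  (forall y, enorm (y - x) <= t ->
     enorm (grad f y - grad f x) <= (1 - 2 / 3 * eta) * q) ->
  eta <= marc_ratio f gamma sigma x.
Proof.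
move=> fd eta0 q0 close.
have t0 : 0 < t.
  rewrite lt_neqAle t_ge0 andbT eq_sym; apply/eqP => t0.
  by move: q0; rewrite enorm_grad_marc_step t0 expr0n /= !mulr0 addr0 ltxx.
have qt0 : 0 < q * t by rewrite mulr_gt0.
have /andP[lo up] := model_decrease_bounds.
have := increment_le f x s _ fd close; rewrite dot_grad_marc_step -/t => inc.
rewrite /marc_ratio -/s ler_pdivlMr; last lra.
have : eta * (f x - cubic_model f gamma sigma x s) <= eta * (2 / 3 * (q * t)).
  by rewrite ler_pM2l.
lra.
Qed.

End Step.

(** * Runs of the algorithm *)

Section Run.
Context {R : realType} {n : nat}.
Variables (f : 'rV[R]_n -> R) (P : marc_constants R).
Variables (x : nat -> 'rV[R]_n) (gamma sigma : nat -> R).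
Hypothesis run : marc_run f x P gamma sigma.
Let g k := grad f (x k).
Let step k := marc_step f (gamma k) (sigma k) (x k).
Let accepted k := eta1 P <= marc_ratio f (gamma k) (sigma k) (x k).

Lemma marc_gamma_bounds k : gamma_min P <= gamma k <= gamma_max P.
Proof.
have minmax := lt_trans (gamma_min_lt_gamma0 P) (gamma0_lt_gamma_max P).
case: k => [|k].
  by rewrite (marc_gamma0 run) !ltW ?gamma_min_lt_gamma0 ?gamma0_lt_gamma_max.
have [h _ ->] := marc_gamma run k.
by rewrite le_max lexx ge_max ge_min lexx orbT (ltW minmax).
Qed.

Lemma marc_gamma_gt0 k : 0 < gamma k.
Proof.
have /andP[+ _] := marc_gamma_bounds k; exact/lt_le_trans/gamma_min_gt0.
Qed.

Lemma marc_sigma_gt0 k : 0 < sigma k.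
Proof.
elim: k => [|k IH]; first by rewrite (marc_sigma0 run) sigma0_gt0.
rewrite (marc_sigma run) /=; case: ifP => _; first by rewrite mulr_gt0 ?c2_gt0.
case: ifP => _ //; rewrite mulr_gt0 //; exact: lt_le_trans (c1_ge1 P).
Qed.

Lemma enorm_grad_step k :
  enorm (g k) = gamma k * enorm (step k) + sigma k * enorm (step k) ^+ 2.
Proof. exact/enorm_grad_marc_step/marc_sigma_gt0/marc_gamma_gt0. Qed.

Lemma marc_sigma_rejected k : ~~ accepted k -> sigma k.+1 = c1 P * sigma k.
Proof.
rewrite /accepted -ltNge => rej; rewrite (marc_sigma run) /=.
by rewrite [eta1 P <= _]leNgt rej ltNge (le_trans (ltW rej) (eta1_le_eta2 P)).
Qed.

Lemma marc_sigma_accepted k : accepted k -> sigma k.+1 <= sigma k.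
Proof.
rewrite /accepted => acc; rewrite (marc_sigma run) /= acc.
case: ifP => // _.
by rewrite ler_piMl ?c2_le1 // ltW // marc_sigma_gt0.
Qed.

Lemma marc_x_accepted k : accepted k -> x k.+1 - x k = step k.
Proof. by rewrite (marc_x run) /accepted => ->; rewrite addrC addKr. Qed.

Lemma marc_decrease k :
  eta1 P / 2 * (enorm (g k) * enorm (x k.+1 - x k)) <= f (x k) - f (x k.+1).
Proof.
have [acc|/negbTE rej] := boolP (accepted k); last first.
  by rewrite (marc_x run) [eta1 P <= _]rej !subrr enorm0 !mulr0.
rewrite marc_x_accepted // (marc_x run) [eta1 P <= _]acc.
exact: accepted_decrease (marc_gamma_gt0 k) (marc_sigma_gt0 k) _
  (eta1_gt0 P) acc.
Qed.

Lemma marc_f_nonincreasing k l : (k <= l)%N -> f (x l) <= f (x k).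
Proof.
move=> /subnK <-; elim: (l - k)%N => [|m IH] //; apply: le_trans IH.
rewrite -subr_ge0; apply: le_trans (marc_decrease _).
by rewrite !mulr_ge0 ?enorm_ge0 ?invr_ge0 // ltW // eta1_gt0.
Qed.

(** Summing [marc_decrease] and using the triangle inequality: while the
gradient stays above e, the distance travelled is paid for by a decrease of f
proportional to it. *)
Lemma marc_displacement (e : R) K l : 0 <= e ->
  (forall k, (K <= k < K + l)%N -> e <= enorm (g k)) ->
  eta1 P / 2 * (e * enorm (x (K + l)%N - x K)) <= f (x K) - f (x (K + l)%N).
Proof.
move=> e0; have eta0 := eta1_gt0 P.
elim: l => [|l IH] big; first by rewrite addn0 !subrr enorm0 !mulr0.
have {}IH : eta1 P / 2 * (e * enorm (x (K + l)%N - x K))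
    <= f (x K) - f (x (K + l)%N).
  by apply: IH => k /andP[Kk kl]; rewrite big // Kk addnS ltnS ltnW.
have dec := marc_decrease (K + l)%N.
have gl : e <= enorm (g (K + l)%N) by rewrite big // leq_addr addnS ltnS /=.
rewrite addnS; set y := x (K + l).+1 in dec *; set z := x (K + l)%N in IH dec *.
have tri : enorm (y - x K) <= enorm (z - x K) + enorm (y - z).
  by have := enormD (z - x K) (y - z); rewrite addrC addrA subrK.
have : e * enorm (y - x K)
    <= e * enorm (z - x K) + enorm (g (K + l)%N) * enorm (y - z).
  apply: le_trans (ler_wpM2l e0 tri) _.
  by rewrite mulrDr lerD2l ler_wpM2r ?enorm_ge0.
have eta_half : 0 <= eta1 P / 2 by lra.
move=> /(ler_wpM2l eta_half) h; lra.
Qed.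


Hypotheses (f_diff : forall y, differentiable f y).
Hypothesis grad_unif : unif_continuous (grad f).
Hypotheses (c1_gt1 : 1 < c1 P) (eta1_lt : eta1 P < 3 / 2).
Hypothesis f_bounded_below : has_lbound (range (fun k => f (x k))).

(** Once f (x N) is within e of the infimum of the values, no later iterate
leaves room for a decrease of e. *)
Lemma marc_f_tail (e : R) : 0 < e ->
  exists N, forall K l, (N <= K)%N -> f (x K) - f (x (K + l)%N) < e.
Proof.
move=> e0.
have fI : has_inf (range (fun k => f (x k))).
  by split=> //; exists (f (x 0%N)), 0%N.
have [_ [N _ <-] Ne] := inf_adherent e0 fI.
exists N => K l /marc_f_nonincreasing NK.
have : inf (range (fun k => f (x k))) <= f (x (K + l)%N).
  by apply: ge_inf => //; exists (K + l)%N.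
lra.
Qed.

(** Late iterates with gradients above e have no decrease of f left to pay for
a displacement longer than the modulus of uniform continuity at e. The range
of k stops short of K + l because at that index the gradient may already be
below e. *)
Lemma marc_grad_drift (e : R) : 0 < e ->
  exists N, forall K l, (N <= K)%N ->
    (forall k, (K <= k < K + l)%N -> e <= enorm (g k)) ->
    enorm (g (K + l)%N - g K) <= e.
Proof.
move=> e0; have [d d0 close] := unif_continuous_enorm _ _ grad_unif e0.
have c0 : 0 < eta1 P / 2 * e by rewrite mulr_gt0 ?divr_gt0 ?eta1_gt0.
have [N tail] := marc_f_tail _ (mulr_gt0 c0 d0).
exists N => K l NK big; apply: close.
have := marc_displacement e K l (ltW e0) big; rewrite mulrA => h.
by rewrite -(ler_pM2l c0) (le_trans h) // ltW // tail.
Qed.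

(** Contrapositive of [short_step_accepted], with a length d that uniform
continuity makes independent of k. *)
Lemma marc_rejected_step (e : R) : 0 < e ->
  exists2 d : R, 0 < d & forall k, e <= enorm (g k) -> ~~ accepted k ->
    d < enorm (step k).
Proof.
move=> e0; have a0 : 0 < 1 - 2 / 3 * eta1 P by move: eta1_lt; lra.
have [d d0 close] := unif_continuous_enorm _ _ grad_unif (mulr_gt0 a0 e0).
exists d => // k ge; rewrite ltNge; apply: contra => sd.
apply: short_step_accepted => // [||||y yx].
- exact: marc_gamma_gt0.
- exact: marc_sigma_gt0.
- exact: eta1_gt0.
- exact: lt_le_trans ge.
- by apply: le_trans (close _ _ (le_trans yx sd)) _; rewrite ler_pM2l.
Qed.

(** The parameter sigma grows only at rejected steps, where
sigma d^2 <= sigma t^2 <= q <= G; one multiplication by c1 then gives the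
bound c1 G / d^2. *)
Lemma marc_sigma_bounded (e : R) K : 0 < e ->
  (forall k, (K <= k)%N -> e <= enorm (g k)) ->
  exists N S, forall k, (N <= k)%N -> sigma k <= S.
Proof.
move=> e0 big; have [d d0 rej] := marc_rejected_step _ e0.
have [N0 drift] := marc_grad_drift _ e0.
pose N := maxn K N0; pose G := enorm (g N) + e.
have KN : (K <= N)%N := leq_maxl _ _.
have gG k : (N <= k)%N -> enorm (g k) <= G.
  move=> /subnKC <-.
  have : enorm (g (N + (k - N))%N - g N) <= e.
    apply: drift => [|j /andP[Nj _]]; first exact: leq_maxr.
    exact/big/(leq_trans KN).
  have := enormD (g N) (g (N + (k - N))%N - g N).
  rewrite (addrC (g N)) subrK /G; lra.
exists N, (Num.max (sigma N) (c1 P * (G / d ^+ 2))) => k /subnKC <-.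
elim: (k - N)%N => [|l IH]; first by rewrite addn0 le_max lexx.
rewrite addnS; have Nl : (N <= N + l)%N := leq_addr _ _.
have [/marc_sigma_accepted|nacc] := boolP (accepted (N + l)%N).
  by move=> h; exact: le_trans IH.
rewrite marc_sigma_rejected // le_max; apply/orP; right.
have gk := big _ (leq_trans KN Nl).
rewrite ler_pM2l ?(lt_le_trans _ (c1_ge1 P)) // ler_pdivlMr ?exprn_gt0 //.
apply: le_trans (gG _ Nl).
rewrite enorm_grad_step.
rewrite ler_wpDl ?mulr_ge0 ?enorm_ge0 ?(ltW (marc_gamma_gt0 _)) //.
rewrite ler_pM2l ?marc_sigma_gt0 // ler_sqr ?nnegrE ?enorm_ge0 ?(ltW d0) //.
exact/ltW/rej.
Qed.

(** With gamma and sigma bounded, e <= gamma t + sigma t^2 keeps t above a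
fixed d, so an accepted step costs a fixed amount of f. *)
Lemma marc_eventually_rejected (e : R) K : 0 < e ->
  (forall k, (K <= k)%N -> e <= enorm (g k)) ->
  exists N, forall k, (N <= k)%N -> ~~ accepted k.
Proof.
move=> e0 big; have [N0 [S sS]] := marc_sigma_bounded _ _ e0 big.
have A0 : 0 < gamma_max P + S.
  have /andP[_ gM] := marc_gamma_bounds N0.
  have := marc_gamma_gt0 N0; have := marc_sigma_gt0 N0.
  have := sS N0 (leqnn _); lra.
(* The minimum with 1 allows t^2 to be replaced by t. *)
pose d := Num.min 1 (e / (gamma_max P + S)).
have d0 : 0 < d by rewrite lt_min ltr01 divr_gt0.
have c0 : 0 < eta1 P / 2 * (e * d) by rewrite !mulr_gt0 ?invr_gt0 ?eta1_gt0.
have [N1 tail] := marc_f_tail _ c0.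
exists (maxn K (maxn N0 N1)) => k; rewrite !geq_max => /and3P[Kk N0k N1k].
apply/negP => acc.
have := tail k 1%N N1k; rewrite addn1 ltNge => /negP; apply.
apply: le_trans (marc_decrease k); rewrite marc_x_accepted //.
rewrite ler_pM2l ?divr_gt0 ?eta1_gt0 // ler_pM ?(ltW e0) ?(ltW d0) ?big //.
have := big _ Kk.
rewrite enorm_grad_step; set t := enorm (step k) => et.
have t0 : 0 <= t := enorm_ge0 _.
rewrite /d ge_min; have [//|t1 /=] := leP 1 t.
rewrite ler_pdivrMr //; apply: le_trans et _.
have /andP[_ gm] := marc_gamma_bounds k.
have h1 : gamma k * t <= gamma_max P * t by rewrite ler_wpM2r.
have h2 : sigma k * t ^+ 2 <= S * t.
  rewrite ler_pM ?(ltW (marc_sigma_gt0 _)) ?sqr_ge0 ?sS //.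
  by rewrite expr2 ler_piMl // ltW.
lra.
Qed.

(** Bernoulli's inequality for the factor c1^l: linear growth suffices to
exceed any bound. *)
Lemma marc_sigma_growth N : (forall k, (N <= k)%N -> ~~ accepted k) ->
  forall l, sigma N * (1 + l%:R * (c1 P - 1)) <= sigma (N + l)%N.
Proof.
move=> rej; have sN := marc_sigma_gt0 N.
elim=> [|l IH]; first by rewrite addn0 mul0r addr0 mulr1.
rewrite addnS marc_sigma_rejected ?rej ?leq_addr //.
rewrite -natr1.
have l0 : 0 <= sigma N * l%:R * (c1 P - 1).
  by rewrite !mulr_ge0 ?(ltW sN) ?subr_ge0 ?(ltW c1_gt1).
have : sigma N <= sigma (N + l)%N by lra.
have c0 : 0 <= c1 P - 1 by rewrite subr_ge0 ltW.
move=> /(ler_wpM2l c0); lra.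
Qed.

Lemma marc_liminf (e : R) K : 0 < e -> exists2 k, (K <= k)%N & enorm (g k) < e.
Proof.
move=> e0; apply: contrapT => no.
have big k : (K <= k)%N -> e <= enorm (g k).
  by move=> Kk; rewrite leNgt; apply/negP => lt; apply: no; exists k.
have [N0 [S sS]] := marc_sigma_bounded _ _ e0 big.
have [N1 rej] := marc_eventually_rejected _ _ e0 big.
pose N := maxn N0 N1.
have grow := marc_sigma_growth N
  (fun k h => rej k (leq_trans (leq_maxr _ _) h)).
have sN := marc_sigma_gt0 N.
have s0 : 0 < sigma N * (c1 P - 1) by rewrite mulr_gt0 ?subr_gt0.
have S0 : 0 <= S.
  by apply: le_trans (sS N _); rewrite ?leq_maxl // ltW.
have := archi_boundP (divr_ge0 S0 (ltW s0)).
set l := Num.bound _; rewrite ltr_pdivrMr // => Sl.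
have := grow l; have := sS (N + l)%N (leq_trans (leq_maxl _ _) (leq_addr _ _)).
lra.
Qed.

Lemma marc_grad_cvg0 : enorm (g k) @[k --> \oo] --> (0 : R).
Proof.
apply/cvgr0Pnorm_le => e e0.
have e2 : 0 < e / 2 by rewrite divr_gt0.
have [N drift] := marc_grad_drift _ e2.
exists N => // K /= NK.
have [k0 Kk0 small0] := marc_liminf (e / 2) K e2.
have ex : exists l, enorm (g (K + l)%N) < e / 2.
  by exists (k0 - K)%N; rewrite subnKC.
(* By minimality of l, the gradients stay above e / 2 from K to K + l - 1. *)
have [l small lmin] := ex_minnP ex.
have : enorm (g (K + l)%N - g K) <= e / 2.
  apply: drift => // k /andP[Kk kl].
  rewrite leNgt; apply/negP => gk.
  have := lmin (k - K)%N; rewrite subnKC // => /(_ gk).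
  by rewrite leqNgt ltn_subLR // kl.
rewrite enorm_distC ger0_norm ?enorm_ge0 //.
have := enormD (g K - g (K + l)%N) (g (K + l)%N); rewrite subrK; lra.
Qed.

End Run.

Theorem theorem3p2 (R : realType) (n : nat) (f : 'rV[R]_n -> R)
    (P : marc_constants R) (x : nat -> 'rV[R]_n) (gamma sigma : nat -> R)
    (f_C1 : C1 f) (grad_unif : unif_continuous (grad f))
    (run : marc_run f x P gamma sigma)
    (c1_gt1 : 1 < c1 P) (eta1_lt : eta1 P < 3 / 2)
    (f_bounded_below : has_lbound (range (fun k => f (x k)))) :
  enorm (grad f (x k)) @[k --> \oo] --> (0 : R).
Proof.
have [f_diff _] := f_C1.
exact: marc_grad_cvg0 run f_diff grad_unif c1_gt1 eta1_lt f_bounded_below.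
Qed.
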